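(* Let $q$ be a prime power, $G=\mathrm{AGL}_1(q)$, $K$ its Frobenius kernel and $C=\langle c\rangle$ a Frobenius complement of $G$. Let $q-1=st$ with positive integers $s,t$ and $t>1$. Let $\{a_0,a_1,\dots,a_{s-1}\}$ be a left transversal of $\langle c^s\rangle$ in $C$ with $a_0\in\langle c^s\rangle\setminus\{1\}$. Set $X:=\big(\bigcup_{i=1}^{s-1}a_i^{G}\big)\cup(K\setminus\{1\})$ and $Y:=\bigcup_{i=0}^{s-1}a_i^{G}$. Then $\langle c^s\rangle$ is a perfect code of $\mathrm{CS}(G,X)$. Moreover, if $a_0$ is a nonsquare of $\langle c^s\rangle$, then $\langle c^s\rangle$ is a total perfect code of $\mathrm{CS}(G,Y)$.
   Context: $\mathrm{AGL}_1(q)$ is the group of affine maps $x\mapsto\alpha x+\beta$ ($\alpha\in\mathbb{F}_q^{*}$, $\beta\in\mathbb{F}_q$) of the finite field $\mathbb{F}_q$; it is a Frobenius group whose Frobenius kernel $K$ (the translations) is elementary abelian of order $q$ and whose Frobenius complements (the point stabilizers, e.g. $\{x\mapsto\alpha x\}$) are cyclic of order $q-1$. $a^G$ is the conjugacy class of $a$. A subset $X$ of $G$ is normal if $g^{-1}Xg=X$ for all $g$; the Cayley sum graph $\mathrm{CS}(G,X)$ has vertex set $G$ with distinct $g,h$ adjacent iff $gh\in X$. A perfect code is an independent vertex set $C$ such that every vertex outside $C$ has exactly one neighbour in $C$; a total perfect code is a vertex set $C$ such that every vertex has exactly one neighbour in $C$. An element $h$ of a subgroup $H$ is a nonsquare of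 $H$ if $h\neq k^2$ for all $k\in H$. *)

(* Defs.v *)
From mathcomp Require Import all_boot all_order all_fingroup all_solvable all_algebra all_field.

Set Implicit Arguments.
Unset Strict Implicit.
Unset Printing Implicit Defensive.

Import GroupScope GRing.Theory.

(* The product of {perm F} is composition read from left to right, so AGL1 F
   is the opposite of the group of affine maps under usual composition; the
   two are isomorphic via inversion. *)
Section AffineGroup.

Variable F : finFieldType.

Definition AGL1 : {set {perm F}} :=
  [set f : {perm F} |
    [exists a : F, exists b : F,
       (a != 0%R) && [forall x : F, f x == (a * x + b)%R]]].

Lemma AGL1P (f : {perm F}) :
  reflect (exists a b : F, a != 0%R /\ forall x, f x = (a * x + b)%R)
          (f \in AGL1).
Proof.
rewrite inE; apply: (iffP existsP) => [[a /existsP[b /andP[a0 /forallP fE]]]|].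
  by exists a, b; split=> // x; apply/eqP.
case=> a [b [a0 fE]]; exists a; apply/existsP; exists b; rewrite a0 /=.
by apply/forallP=> x; rewrite fE.
Qed.

Lemma AGL1_group_set : group_set AGL1.
Proof.
apply/group_setP; split=> [|f g /AGL1P[a [b [a0 fE]]] /AGL1P[d [e [d0 gE]]]].
  apply/AGL1P; exists 1%R, 0%R; split=> [|x]; first exact: oner_neq0.
  by rewrite perm1 mul1r addr0.
apply/AGL1P; exists (d * a)%R, (d * b + e)%R; split=> [|x].
  by rewrite mulf_neq0.
by rewrite permM fE gE mulrDr mulrA addrA.
Qed.

Canonical AGL1_group := Group AGL1_group_set.

End AffineGroup.

(* A graph is given by its vertex set V and its adjacency relation e, of which
   only the restriction to V matters. *)
Section PerfectCodes.

Variables (T : finType) (V : {set T}) (e : rel T).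

Definition neighbours_in (C : {set T}) (x : T) : {set T} := [set y in C | e x y].

Definition independent (C : {set T}) : bool :=
  [forall x in C, forall y in C, ~~ e x y].

Definition perfect_code (C : {set T}) : bool :=
  [&& C \subset V, independent C
    & [forall x in V :\: C, #|neighbours_in C x| == 1%N]].

Definition total_perfect_code (C : {set T}) : bool :=
  (C \subset V) && [forall x in V, #|neighbours_in C x| == 1%N].

End PerfectCodes.

Section CayleySum.

Variable gT : finGroupType.

(* The adjacency relation of CS(G, X), whose vertex set is G. *)
Definition CS (X : {set gT}) : rel gT :=
  [rel g h | (g != h) && (g * h \in X)].

Lemma CS_sym (G : {group gT}) (X : {set gT}) :
  G \subset 'N(X) -> {in G &, symmetric (CS X)}.
Proof.
move=> nXG g h Gg Gh; rewrite /CS /= eq_sym; congr (_ && _).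
by rewrite -(memJ_norm (g * h) (subsetP nXG g Gg)) conjgE mulgA mulKg.
Qed.

Definition nonsquare (H : {set gT}) (h : gT) : bool :=
  (h \in H) && [forall k in H, h != k ^+ 2].

End CayleySum.

(* Main.v *)
(* Let T be the group of translations.  The centralizer in AGL1 of a nontrivial
   translation is T, whereas for f in AGL1 outside T the group T * C(f) is all
   of AGL1; so T is the only Frobenius kernel.  With C the complement, which is
   abelian, the class of d <> 1 in C is the coset K d.  Hence, writing x = k d
   with k in K and d in C, the product x y with y in H := <c^s> lies in the
   union of the classes of a family A in C^# iff d y is in A, and the coset d H
   meets the transversal exactly once.  For X, the coset H itself is served by
   K^# instead of a_0; for Y, loops are excluded since a_0 is not a square. *)

Require Import Defs.
From mathcomp Require Import all_boot all_order all_fingroup all_solvable all_algebra all_field.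
From mathcomp Require Import all_character ring.

Set Implicit Arguments.
Unset Strict Implicit.
Unset Printing Implicit Defensive.

Import GroupScope.

(** * Translations as the only Frobenius kernel of the affine group *)

Section Translations.

Variable F : finFieldType.
Implicit Types (a b p : F) (f g : {perm F}).

Definition translation b : {perm F} := perm (GRing.addIr b).

Lemma translationE b x : translation b x = (x + b)%R.
Proof. by rewrite permE. Qed.

Definition translations : {set {perm F}} := [set translation b | b : F].

Lemma translationM b p : translation b * translation p = translation (b + p)%R.
Proof. by apply/permP=> x; rewrite permM !translationE GRing.addrA. Qed.

Lemma translation0 : translation 0%R = 1.
Proof. by apply/permP=> x; rewrite translationE perm1 GRing.addr0. Qed.

Lemma translation_inj : injective translation.
Proof.
by move=> b p /permP/(_ 0%R); rewrite !translationE !GRing.add0r.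
Qed.

Lemma translations_group_set : group_set translations.
Proof.
apply/group_setP; split=> [|_ _ /imsetP[b _ ->] /imsetP[p _ ->]].
  by rewrite -translation0 imset_f.
by rewrite translationM imset_f.
Qed.

Canonical translations_group := Group translations_group_set.

Lemma card_translations : #|translations| = #|F|.
Proof. by rewrite card_imset //; apply: translation_inj. Qed.

Lemma translations_abelian : abelian translations.
Proof.
apply/centsP=> _ /imsetP[b _ ->] _ /imsetP[p _ ->].
by rewrite /commute !translationM GRing.addrC.
Qed.

Lemma translations_AGL1 : translations \subset AGL1 F.
Proof.
apply/subsetP=> _ /imsetP[b _ ->]; apply/AGL1P; exists 1%R, b.
by split=> [|x]; rewrite ?GRing.oner_neq0 // translationE GRing.mul1r.
Qed.

Lemma affine_perm a b :
  a != 0%R -> exists2 f, f \in AGL1 F & forall x, f x = (a * x + b)%R.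
Proof.
move=> a0; have fI : injective (fun x : F => (a * x + b)%R).
  by move=> x y /GRing.addIr/(GRing.mulfI a0).
exists (perm fI) => [|x]; last by rewrite permE.
by apply/AGL1P; exists a, b; split=> // x; rewrite permE.
Qed.

Lemma translationJ f a b p :
  (forall x, f x = (a * x + b)%R) -> translation p ^ f = translation (a * p)%R.
Proof.
move=> fE; apply: (mulgI f); rewrite -conjgC; apply/permP=> x.
by rewrite !permM !translationE !fE GRing.mulrDr GRing.addrAC.
Qed.

Lemma translations_normal : translations <| AGL1 F.
Proof.
rewrite /normal translations_AGL1; apply/normsP=> f /AGL1P[a [b [_ fE]]].
apply/eqP; rewrite eqEcard cardJg leqnn andbT.
apply/subsetP=> _ /imsetP[_ /imsetP[p _ ->] ->].
by rewrite (translationJ _ fE) imset_f.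
Qed.

(** Conjugation by [x |-> a x + d] multiplies the shift [b] by [a], so commuting with a nonzero
    shift forces [a = 1]. *)
Lemma cent1_translation b : b != 0%R -> 'C_(AGL1 F)[translation b] = translations.
Proof.
move=> b0; apply/eqP; rewrite eqEsubset subsetI translations_AGL1 andbC /=.
rewrite sub_cent1 (subsetP translations_abelian) ?imset_f //=.
apply/subsetP=> f /setIP[/AGL1P[a [d [_ fE]]] /cent1P cfb].
have /eqP : translation b ^ f = translation b by rewrite /conjg -cfb mulKg.
rewrite (translationJ _ fE) (inj_eq translation_inj) -[X in _ == X]GRing.mul1r.
rewrite (inj_eq (GRing.mulIf b0)) => /eqP a1.
suff -> : f = translation d by rewrite imset_f.
by apply/permP=> x; rewrite fE a1 GRing.mul1r translationE.
Qed.

(** The index is the size of the class of [translation 1], by the centralizer just found. The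
    homothety of ratio [a] conjugates this translation to [translation a], so the class consists of
    all nontrivial translations. *)
Lemma index_translations : #|AGL1 F : translations| = #|F|.-1.
Proof.
have o0 : 1%R != 0%R :> F by apply: GRing.oner_neq0.
rewrite -(cent1_translation o0) index_cent1.
have -> : translation 1%R ^: AGL1 F = translations^#.
  apply/setP=> f; rewrite !inE; apply/imsetP/andP => [[g /AGL1P[a [b [a0 gE]]] ->]|].
    rewrite (translationJ _ gE) -translation0 (inj_eq translation_inj).
    by rewrite GRing.mulr1 a0 imset_f.
  case=> f1 /imsetP[a _ fE]; subst f; move: f1.
  rewrite -translation0 (inj_eq translation_inj) => a0.
  have [g Gg gE] := affine_perm 0%R a0.
  by exists g => //; rewrite (translationJ _ gE) GRing.mulr1.
by rewrite -card_translations (cardsD1 1 translations) group1.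
Qed.

(* The map f : x |-> a x + b fixes p := b / (1 - a), and commutes with every
   element of AGL1 fixing p. *)
Lemma AGL1_translations_cent1 f : f \in AGL1 F -> f \notin translations ->
  AGL1 F \subset translations * 'C_(AGL1 F)[f].
Proof.
move=> /AGL1P[a [b [a0 fE]]] nTf.
have a1 : (1 - a)%R != 0%R.
  rewrite GRing.subr_eq0; apply: contra nTf => /eqP a1; apply/imsetP; exists b => //.
  by apply/permP=> x; rewrite fE translationE -a1 GRing.mul1r.
have [p fp] : exists p, (b = p - a * p)%R.
  exists (b / (1 - a))%R; set p := (_ / _)%R.
  by rewrite -{1}[p]GRing.mul1r -GRing.mulrBl GRing.mulrC GRing.divfK.
apply/subsetP=> g /AGL1P[d [e [d0 gE]]].
have [h Gh hE] := affine_perm (p - d * p)%R d0.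
(* Since [h] fixes [p] and has ratio [d], the shift [u] must solve
   [d * (x + u) + (p - d * p) = d * x + e]. *)
apply/mulsgP; exists (translation (p + (e - p) / d)%R) h; first exact: imset_f.
  rewrite inE Gh; apply/cent1P/permP=> x; rewrite !permM !hE !fE fp.
  by ring.
apply/permP=> x; rewrite permM translationE hE gE !GRing.mulrDr.
by rewrite [(d * (_ / d))%R]GRing.mulrC GRing.divfK //; ring.
Qed.

(** A Frobenius kernel contains the centralizers of its nontrivial elements. An element outside the
    translations would thus put both factors of [AGL1_translations_cent1] inside [K], making [K] the
    whole group. *)
Lemma AGL1_Frobenius_ker (K : {group {perm F}}) :
  [Frobenius AGL1 F with kernel K] -> K :=: translations.
Proof.
move=> /Frobenius_kerP[ntK /andP[sKG pKG] nKG cK].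
have cT x : x \in K^# -> x \in translations -> translations \subset K.
  move=> Kx /(subsetP translations_abelian) Tx.
  apply: subset_trans (cK x Kx).
  by rewrite subsetI translations_AGL1 sub_cent1.
suff sKT: K \subset translations.
  have [x Kx x1] := trivgPn _ ntK.
  apply/eqP; rewrite eqEsubset sKT (cT x) ?inE ?x1 //.
  exact: (subsetP sKT).
apply/subsetP=> f Kf; apply: contraR pKG => nTf.
have Gf := subsetP sKG f Kf.
have o0 : 1%R != 0%R :> F by apply: GRing.oner_neq0.
have f1 : f != 1 by apply: contra nTf => /eqP->.
have sTK : translations \subset K.
  (* Two normal subgroups that meet trivially commute, and then [f] would centralize a nontrivial
     translation without being one. Otherwise a common nontrivial element brings its centralizer
     into [K]. *)
  have [tiKT | ] := eqVneq (K :&: translations) 1.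
    have cKT : K \subset 'C(translations).
      apply/commG1P/trivgP; rewrite -tiKT commg_subI //.
        by rewrite subsetI subxx (subset_trans sKG) ?normal_norm ?translations_normal.
      by rewrite subsetI subxx (subset_trans translations_AGL1) ?normal_norm.
    case/negP: nTf; rewrite -(cent1_translation o0).
    rewrite inE Gf -cent_set1 (subsetP (centS _) f (subsetP cKT f Kf)) //.
    by rewrite sub1set imset_f.
  by case/trivgPn=> x /setIP[Kx Tx] x1; apply: (cT x); rewrite // !inE x1.
apply: subset_trans (AGL1_translations_cent1 Gf nTf) _.
by rewrite mul_subG // cK // !inE f1.
Qed.

End Translations.

Lemma CSE (gT : finGroupType) (X : {set gT}) x y :
  CS X x y = (x != y) && (x * y \in X).
Proof. by []. Qed.

(** * Conjugacy classes in a Frobenius group with abelian complement *)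

Section AbelianComplement.

Variables (gT : finGroupType) (G K C : {group gT}).
Hypotheses (frobG : [Frobenius G = K ><| C]) (abC : abelian C).

Let defG : K ><| C = G. Proof. by case: (Frobenius_context frobG). Qed.
Let tiKC : K :&: C = 1. Proof. by case/sdprod_context: defG. Qed.
Let sCG : C \subset G. Proof. by case/sdprod_context: defG. Qed.

Let mem_compl_ker x : x \in C -> (x \in K) = (x == 1).
Proof.
move=> Cx; apply/idP/eqP=> [Kx | -> //].
by apply/set1P; rewrite -[[set 1]]tiKC inE Kx.
Qed.

(** The quotient by [K] is abelian, so the class lies in the coset; the centralizer of [d] is [C],
    so the class has [#|G : C| = #|K|] elements and fills it. *)
Lemma Frobenius_compl_class d : d \in C^# -> d ^: G = K :* d.
Proof.
move=> C1d; have /setD1P[d1 Cd] := C1d; have [nKG _ _ _ _] := sdprod_context defG.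
have dG : G^`(1) \subset K.
  by rewrite der1_min ?normal_norm // -(isog_abelian (sdprod_isog defG)).
have cd : 'C_G[d] = C.
  apply/eqP; rewrite eqEsubset subsetI sCG sub_cent1 (subsetP abC) //.
  have /andP[_ /andP[_ tiC]] := frobG.
  by rewrite (cent1_normedTI tiC).
apply/eqP; rewrite eqEcard card_rcoset -index_cent1 cd.
rewrite -divgS // -(sdprod_card defG) mulnK ?cardG_gt0 // leqnn andbT.
apply/subsetP=> _ /imsetP[g Gg ->]; rewrite mem_rcoset.
have -> : d ^ g * d^-1 = [~ g, d^-1] by rewrite commgEl /conjg invgK !mulgA.
by rewrite (subsetP dG) // mem_commg // groupV (subsetP sCG).
Qed.

Lemma mem_Frobenius_compl_class k d e :
  k \in K -> d \in C -> e \in C^# -> (k * d \in e ^: G) = (d == e).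
Proof.
move=> Kk Cd C1e; have /setD1P[_ Ce] := C1e.
rewrite (Frobenius_compl_class C1e) mem_rcoset -mulgA groupMl // eq_mulgV1.
by rewrite mem_compl_ker // groupM ?groupV.
Qed.

Lemma mem_bigcup_compl_classes (r : seq gT) k d :
    k \in K -> d \in C -> {subset r <= C^#} ->
  (k * d \in \bigcup_(x <- r) (x ^: G)) = (d \in r).
Proof.
move=> Kk Cd; elim: r => [|x r IHr] rC; first by rewrite big_nil inE.
rewrite big_cons !inE mem_Frobenius_compl_class ?rC ?mem_head // IHr // => y ry.
by rewrite rC // inE ry orbT.
Qed.

(** * Perfect codes from a transversal in the complement *)

Section Codes.

Variables (H : {group gT}) (s : seq gT) (a0 : gT).
Hypothesis sHC : H \subset C.
Hypothesis trs : is_transversal [set x in a0 :: s] (lcosets H C) C.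
Hypotheses (uniqs : uniq (a0 :: s)) (Ha0 : a0 \in H^#).

Let trsE d : d \in C ->
  exists2 y, y \in H & {in H, forall z, (d * z \in a0 :: s) = (z == y)}.
Proof.
move=> Cd; have /and3P[_ _ /forall_inP/(_ (d *: H))] := trs.
have -> : d *: H \in lcosets H C by apply/lcosetsP; exists d.
move=> /(_ isT) /cards1P[x defx].
have /setIP[sx] : x \in [set x in a0 :: s] :&: d *: H by rewrite defx set11.
case/lcosetP=> y Hy xE; exists y => // z Hz.
have := in_set1 (d * z) x; rewrite -defx {1}xE (inj_eq (mulgI d)) => <-.
by rewrite in_setI in_set mem_lcoset mulKg Hz andbT.
Qed.

Let trsH d : d \in H -> (d \in a0 :: s) = (d == a0).
Proof.
have [y Hy yE] := trsE (group1 C); move=> Hd.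
have /setD1P[_ H0] := Ha0.
have := yE _ H0; rewrite mul1g mem_head => /esym/eqP a0E.
by rewrite -[in LHS](mul1g d) yE // a0E.
Qed.

(** The coset [H] is already represented by [a0 <> 1], so [1] is not in the transversal; the
    description of classes therefore applies to every representative. *)
Let sC1 : {subset a0 :: s <= C^#}.
Proof.
move=> x sx; have /and3P[_ /subsetP sC _] := trs.
rewrite !inE sC ?in_set // andbT; apply/eqP=> x1.
have /setD1P[a01 _] := Ha0; case/negP: a01.
by rewrite eq_sym -trsH // -x1.
Qed.

Let s_H d : d \in H -> d \notin s.
Proof.
move=> Hd; apply/negP=> sd; have := trsH Hd; rewrite inE sd orbT => /esym/eqP d0.
by move: uniqs; rewrite /= -d0 sd.
Qed.

Lemma transversal_total_perfect_code :
  nonsquare H a0 ->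
  total_perfect_code G (CS (\bigcup_(x <- a0 :: s) (x ^: G))) H.
Proof.
case/andP=> _ /forall_inP nsq.
apply/andP; split; first exact: subset_trans sHC sCG.
apply/forall_inP=> x Gx; have [k [d [Kk Cd xE _]]] := mem_sdprod defG Gx.
have [y Hy yE] := trsE Cd.
suff -> : neighbours_in (CS (\bigcup_(x <- a0 :: s) (x ^: G))) H x = [set y].
  by rewrite cards1.
apply/setP=> z; rewrite !inE; have [Hz|/=] := boolP (z \in H); last first.
  by move=> nHz; apply/esym; apply: contraNF nHz => /eqP->.
have Cz := subsetP sHC z Hz.
rewrite CSE xE -mulgA mem_bigcup_compl_classes ?groupM // yE // -xE.
have [zy|] := eqVneq z y; last by rewrite andbF.
(* A loop [x = z] would give [k = 1] and [d = z], so [z ^+ 2] would be the representative of [H],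
   namely the nonsquare [a0]. *)
rewrite andbT; apply/eqP=> xz.
have Kk1 : k = 1.
  by apply/eqP; rewrite -mem_compl_ker // -(groupMr _ Cd) -xE xz.
have dz : d = z by rewrite -xz xE Kk1 mul1g.
have : d * z \in a0 :: s by rewrite yE // zy.
by rewrite dz trsH ?groupM //; apply/negP; rewrite eq_sym; apply: nsq.
Qed.

Lemma transversal_perfect_code :
  perfect_code G (CS ((\bigcup_(x <- s) (x ^: G)) :|: K^#)) H.
Proof.
have sC : {subset s <= C^#}.
  by move=> x sx; rewrite sC1 // inE sx orbT.
have XE k d : k \in K -> d \in C ->
  (k * d \in (\bigcup_(x <- s) (x ^: G)) :|: K^#)
    = (d \in s) || (k * d != 1) && (d == 1).
  move=> Kk Cd; rewrite in_setU mem_bigcup_compl_classes // !inE groupMl //.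
  by rewrite mem_compl_ker.
apply/and3P; split; first exact: subset_trans sHC sCG.
  (* The product of two elements of [H] stays in [H], which contains no element of [s] and meets [K]
     only in [1]. *)
  apply/forall_inP=> x Hx; apply/forall_inP=> y Hy; rewrite CSE negb_and orbC.
  have Hxy := groupM Hx Hy.
  rewrite -[x * y]mul1g XE // ?(subsetP sHC) // (negbTE (s_H Hxy)) mul1g.
  by rewrite andNb.
apply/forall_inP=> x /setDP[Gx nHx].
have [k [d [Kk Cd xE _]]] := mem_sdprod defG Gx.
have nxz z : z \in H -> (x != z) = true.
  by move=> Hz; apply: contraNneq nHx => ->.
(* If [d] is in [H], no [d * z] is in [s], so adjacency must come from [K^#]: this forces
   [z = d^-1], with product [k], nontrivial because [x] is outside [H]. If not, [d * z] avoids both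
   [1] and [a0], so the neighbour is given by the transversal. *)
have [Hd | nHd] := boolP (d \in H).
  suff -> : neighbours_in (CS (\bigcup_(x <- s) (x ^: G) :|: K^#)) H x
            = [set d^-1].
    by rewrite cards1.
  apply/setP=> z; rewrite inE in_set1 /=.
  have [Hz|/=] := boolP (z \in H); last first.
    by move=> nHz; apply/esym; apply: contraNF nHz => /eqP->; rewrite groupV.
  rewrite CSE nxz //= xE -mulgA XE ?groupM ?(subsetP sHC z) //.
  rewrite (negbTE (s_H _)) ?groupM //=.
  rewrite -(eq_invg_mul d z) [d^-1 == z]eq_sym.
  have [-> | _] := eqVneq z d^-1; last by rewrite andbF.
  rewrite mulgV mulg1 andbT; apply: contraNneq nHx => k1.
  by rewrite xE k1 mul1g.
have [y Hy yE] := trsE Cd.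
suff -> : neighbours_in (CS (\bigcup_(x <- s) (x ^: G) :|: K^#)) H x = [set y].
  by rewrite cards1.
apply/setP=> z; rewrite inE in_set1 /=.
have [Hz|/=] := boolP (z \in H); last first.
  by move=> nHz; apply/esym; apply: contraNF nHz => /eqP->.
have nHdz : d * z \notin H by rewrite groupMr.
rewrite CSE nxz //= xE -mulgA XE ?groupM ?(subsetP sHC z) // -yE // inE.
have /setD1P[_ H0] := Ha0.
have /negbTE-> : d * z != 1 by apply: contraNneq nHdz => ->.
have /negbTE-> : d * z != a0 by apply: contraNneq nHdz => ->.
by rewrite andbF orbF.
Qed.

End Codes.
End AbelianComplement.

(** * Specialization to the affine group and its cyclic complement *)

Theorem theorem5p13 (q : nat) (F : finFieldType) (hq : #|F| = q)
    (K : {group {perm F}}) (c : {perm F})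
    (hK : [Frobenius AGL1 F with kernel K])
    (hC : [Frobenius AGL1 F with complement <[c]>])
    (s t : nat) (hs : (0 < s)%N) (ht : (1 < t)%N) (hst : (q - 1 = s * t)%N)
    (a : nat -> {perm F})
    (ha : is_transversal [set a (i : nat) | i : 'I_s]
            (lcosets <[c ^+ s]> <[c]>) <[c]>)
    (ha0 : a 0%N \in <[c ^+ s]>^#) :
  let G := AGL1 F in
  let X := (\bigcup_(1 <= i < s) (a i ^: G)) :|: K^# in
  let Y := \bigcup_(0 <= i < s) (a i ^: G) in
  perfect_code G (CS X) <[c ^+ s]> /\
  (nonsquare <[c ^+ s]> (a 0%N) -> total_perfect_code G (CS Y) <[c ^+ s]>).
Proof.
(* The complement comes with some kernel [K']; uniqueness of the kernel identifies it with [K]. *)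
have [K' frobG'] := @Frobenius_kernel_exists _ _ <[c]>%G hC.
have eqK : K' = K.
  apply/val_inj; rewrite /= (AGL1_Frobenius_ker hK).
  exact: AGL1_Frobenius_ker (FrobeniusWker frobG').
rewrite {K'}eqK in frobG'; have [defG _ _ _ _] := Frobenius_context frobG'.
have oc : #[c] = (s * t)%N.
  rewrite -hst -hq subn1 -index_translations -(AGL1_Frobenius_ker hK) orderE.
  have [/andP[sKG _] _ _ _ _] := sdprod_context defG.
  by rewrite -divgS // -(sdprod_card defG) mulKn.
have sHC : <[c ^+ s]> \subset <[c]> by rewrite cycleX.
have iH : #|<[c]> : <[c ^+ s]>| = s.
  rewrite -divgS // -!orderE orderXdiv oc ?dvdn_mulr // mulKn // mulnK //.
  exact: ltnW.
have iotaE : index_iota 0 s = 0%N :: index_iota 1 s.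
  by rewrite /index_iota subn0 subn1; case: (s) hs.
have setE : [set a (i : nat) | i : 'I_s] = [set x in map a (index_iota 0 s)].
  apply/setP=> x; rewrite in_set; apply/imsetP/mapP=> [[i _ ->] | [i]].
    by exists (val i); rewrite // mem_index_iota /=.
  by rewrite mem_index_iota /= => lti ->; exists (Ordinal lti).
(* The transversal has as many elements as there are cosets, namely [s], so the [s] listed values of
   [a] are pairwise distinct. *)
have := card_transversal ha; rewrite card_lcosets iH setE cardsE => oA.
have uniqA : uniq (map a (index_iota 0 s)).
  by apply/card_uniqP; rewrite oA size_map size_iota subn0.
rewrite setE iotaE /= in ha; rewrite iotaE /= in uniqA.
split.
  have := transversal_perfect_code frobG' (cycle_abelian c)
    (H := <[c ^+ s]>%G) sHC ha uniqA ha0.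
  by rewrite big_map.
have := transversal_total_perfect_code frobG' (cycle_abelian c)
  (H := <[c ^+ s]>%G) sHC ha ha0.
by rewrite -map_cons -iotaE big_map.
Qed.
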